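(* Let $(w_i)_{i\in\mathcal I}$ satisfy $w_i\ge0$ and $\sum_{i\in\mathcal I}w_i\le1$. For each $i\in\mathcal I$ let $M_i=(M_{i,t})_{t\ge0}$ be a global $e$-process for $H_i$ with dormant value one before activation, i.e. $M_{i,t}=1$ for $t<a_i$. Then, under arbitrary dependence among the processes $M_i$, the family $$E_t^{S,w}=1+\sum_{i\in S}w_i(M_{i,t}-1),\qquad S\subseteq\mathcal I\text{ finite},\ t\ge0,$$ is a neutral-padding projectively consistent dynamic intersection $e$-process collection.
   Context: Let $(\Omega,\mathcal F,(\mathcal F_t)_{t\in\mathbb N_0})$ be a discrete-time filtered measurable space, $\mathcal M$ a family of probability measures on $(\Omega,\mathcal F)$, $\mathcal I\subseteq\mathbb N$ an index set (finite or infinite), and $H_i\subseteq\mathcal M$, $i\in\mathcal I$, null hypotheses; for finite $S\subseteq\mathcal I$, $H_S=\bigcap_{i\in S}H_i$ (with $H_\varnothing=\mathcal M$). The active sets $I_t\subseteq\mathcal I$ are deterministic and finite with $I_0\subseteq I_1\subseteq\cdots$ and $\bigcup_t I_t=\mathcal I$; $a_i=\min\{t:i\in I_t\}$ is the activation time of hypothesis $i$. A nonnegative $(\mathcal F_t)$-adapted process $E=(E_t)_{t\ge0}$ is a (global) $e$-process for $H\subseteq\mathcal M$ if $\mathbb E_P[E_\tau]\le1$ for every $P\in H$ and every $(\mathcal F_t)$-stopping time $\tau$ with $P(\tau<\infty)=1$. A dynamic intersection $e$-process collection is a family $\mathbf E=(E^S_t)_{t\ge0,\ S\subseteq\mathcal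 I,\ 0<|S|<\infty}$ such that $E^S$ is an $e$-process for $H_S$ for each nonempty finite $S$. It is neutral-padding projectively consistent if it can be extended to the empty index set by an adapted bookkeeping process $E^\varnothing$ such that, pointwise on $\Omega$, $E^S_t=E^{S\cap I_t}_t$ for every finite $S$ and every $t$. *)

(* Defs.v *)
From HB Require Import structures.
From mathcomp Require Import all_boot all_order all_algebra.
From mathcomp Require Import finmap.
From mathcomp Require Import all_classical all_reals all_analysis.

Set Implicit Arguments.
Unset Strict Implicit.
Unset Printing Implicit Defensive.

Import Order.TTheory GRing.Theory Num.Theory.
Import numFieldNormedType.Exports.

Local Open Scope classical_set_scope.
Local Open Scope ring_scope.

Section Processes.
Context (d : measure_display) (T : measurableType d) (R : realType).

Definition filtration (F : nat -> set (set T)) : Prop :=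
  [/\ forall t, sigma_algebra [set: T] (F t),
      forall t, F t `<=` measurable &
      forall s t, (s <= t)%N -> F s `<=` F t].

(* For a sigma-algebra [F t], the measurable sets of
   [g_sigma_algebraType (F t)] are exactly the members of [F t]. *)
Definition adapted (F : nat -> set (set T)) (X : nat -> T -> R) : Prop :=
  forall t, measurable_fun [set: g_sigma_algebraType (F t)]
                           (X t : g_sigma_algebraType (F t) -> R).

(* Random times take values in N u {oo}; [None] stands for oo. *)
Definition stopping_time (F : nat -> set (set T)) (tau : T -> option nat) :
    Prop :=
  forall t, F t [set x | exists2 s, tau x = Some s & (s <= t)%N].

(* The value 0 at [tau x = oo] is a convention: stopped values are only used
   for times that are almost surely finite. *)
Definition stopped (X : nat -> T -> R) (tau : T -> option nat) (x : T) : R :=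
  if tau x is Some t then X t x else 0.

Definition e_process (F : nat -> set (set T)) (H : set (probability T R))
    (E : nat -> T -> R) : Prop :=
  [/\ forall t x, 0 <= E t x,
      adapted F E &
      forall (P : probability T R) (tau : T -> option nat),
        H P -> stopping_time F tau ->
        P [set x | exists t, tau x = Some t] = 1%E ->
        ('E_P[stopped E tau] <= 1)%E].

(* The intersection is taken within [M], so that the null attached to the
   empty index set is [M] itself. *)
Definition intersection_null (M : set (probability T R))
    (H : nat -> set (probability T R)) (S : {fset nat}) :
    set (probability T R) :=
  M `&` \bigcap_(i in [set` S]) H i.

(* Families are total functions of the finite index set; only the nonempty
   [S] contained in [I] are members of the collection. *)
Definition dynamic_intersection_e_process_collection
    (F : nat -> set (set T)) (M : set (probability T R)) (I : set nat)
    (H : nat -> set (probability T R))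
    (E : {fset nat} -> nat -> T -> R) : Prop :=
  forall S : {fset nat}, [set` S] `<=` I -> S != fset0 ->
    e_process F (intersection_null M H S) (E S).

Definition extend_empty (E0 : nat -> T -> R)
    (E : {fset nat} -> nat -> T -> R) (S : {fset nat}) : nat -> T -> R :=
  if S == fset0 then E0 else E S.

(* The value of [E] at the empty index set is ignored. *)
Definition neutral_padding_projectively_consistent
    (F : nat -> set (set T)) (I : set nat) (A : nat -> {fset nat})
    (E : {fset nat} -> nat -> T -> R) : Prop :=
  exists2 E0 : nat -> T -> R, adapted F E0 &
    forall S : {fset nat}, [set` S] `<=` I -> forall t x,
      extend_empty E0 E S t x = extend_empty E0 E (S `&` A t)%fset t x.

Definition weighted_family (w : nat -> R) (M : nat -> nat -> T -> R)
    (S : {fset nat}) (t : nat) (x : T) : R :=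
  1 + \sum_(i <- S) w i * (M i t x - 1).

End Processes.

Definition active_sets (I : set nat) (A : nat -> {fset nat}) : Prop :=
  (forall s t, (s <= t)%N -> (A s `<=` A t)%fset) /\
  \bigcup_t [set` A t] = I.

(* The least [t] with [i \in A t]; the value 0 is junk for an index that is
   never activated. *)
Definition activation_time (A : nat -> {fset nat}) (i : nat) : nat :=
  if pselect (exists t, i \in A t) is left ex then ex_minn ex else 0%N.

(* Main.v *)
Require Import Defs.
From HB Require Import structures.
From mathcomp Require Import all_boot all_order all_algebra.
From mathcomp Require Import finmap.
From mathcomp Require Import all_classical all_reals all_analysis.
From mathcomp Require Import measurable_realfun.

Import Order.TTheory GRing.Theory Num.Theory.
Import numFieldNormedType.Exports.

Local Open Scope classical_set_scope.
Local Open Scope ring_scope.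

(** The weighted family is a convex combination: with [W] the sum of the
    weights over [S],
      [1 + \sum_(i in S) w i * (M i t - 1)
         = (1 - W) + \sum_(i in S) w i * M i t],
    where [0 <= W <= 1] because a finite sum of nonnegative weights is at most
    their sum over [I].  Hence it is nonnegative, and by linearity its
    expectation at a stopping time is at most [(1 - W) + W = 1] under every [P]
    that belongs to all the [H i]; no joint law of the [M i] enters.  This is
    [weighted_family_e_process], whose one measure-theoretic ingredient is the
    measurability of stopped processes ([measurable_stopped]).

    Consistency holds because an index of [S] that is not active at time [t]
    contributes [w i * (1 - 1) = 0]; the bookkeeping process at the empty set
    is the constant [1], the value of the formula at the empty sum. *)

Section StoppedProcesses.
Context (d : measure_display) (T : measurableType d) (R : realType)
  (F : nat -> set (set T)).

Lemma adapted_measurable (X : nat -> T -> R) (t : nat) :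
  filtration F -> adapted F X -> measurable_fun [set: T] (X t).
Proof.
move=> [saF Fm _] aX _ Y mY.
have /= := aX t measurableT Y mY.
by rewrite measurable_g_measurableTypeE//; exact: Fm.
Qed.

Lemma measurable_stopping_time_eq (tau : T -> option nat) (t : nat) :
  filtration F -> stopping_time F tau -> measurable [set x | tau x = Some t].
Proof.
move=> [_ Fm _] st.
pose L n := [set x | exists2 s, tau x = Some s & (s <= n)%N].
have mL n : measurable (L n) by exact: Fm (st n).
have -> : [set x | tau x = Some t] =
          L t `\` \bigcup_(n in [set n | (n < t)%N]) L n.
  apply/seteqP; split => x /=.
    move=> tx; split; first by exists t.
    by move=> [n /= nt [s]]; rewrite tx => -[<-]; rewrite leqNgt nt.
  move=> [[s ts]]; rewrite leq_eqVlt => /predU1P[<-//|st' nL].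
  by exfalso; apply: nL; exists s => //; exists s.
by apply: measurableD => //; apply: bigcup_measurable.
Qed.

(** The countable partition into the events [tau = oo] and [tau = t] reduces
    measurability of the stopped value to that of each [X t]. *)
Lemma measurable_stopped (X : nat -> T -> R) (tau : T -> option nat) :
  filtration F -> adapted F X -> stopping_time F tau ->
  measurable_fun [set: T] (stopped X tau).
Proof.
move=> fF aX st.
have meq := fun t => measurable_stopping_time_eq tau t fF st.
pose D n := if n is t.+1 then [set x | tau x = Some t]
            else ~` \bigcup_t [set x | tau x = Some t].
have mD n : measurable (D n).
  by case: n => [|n] //=; apply/measurableC/bigcupT_measurable.
have -> : [set: T] = \bigcup_n D n.
  apply/esym/seteqP; split => // x _.
  case tx : (tau x) => [t|]; first by exists t.+1.
  by exists 0%N => //= -[t _ /=]; rewrite tx.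
apply/measurable_fun_bigcup => // -[|t].
  apply: (eq_measurable_fun (cst 0 : T -> R)) => // x /set_mem/= nx.
  rewrite /stopped; case tx : (tau x) => [t|] //.
  by exfalso; apply: nx; exists t.
apply: (eq_measurable_fun (X t)).
  by move=> x /set_mem/= tx; rewrite /stopped tx.
by apply: measurable_funTS; exact: adapted_measurable.
Qed.

End StoppedProcesses.

Section WeightedFamily.
Context (d : measure_display) (T : measurableType d) (R : realType).
Implicit Types (w : nat -> R) (M : nat -> nat -> T -> R) (S : {fset nat}).

Lemma weighted_family_convexE w M S t x :
  weighted_family w M S t x =
  (1 - \sum_(i <- S) w i) + \sum_(i <- S) w i * M i t x.
Proof.
rewrite /weighted_family -addrA; congr (_ + _).
rewrite addrC -sumrB; apply: eq_bigr => i _.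
by rewrite mulrBr mulr1.
Qed.

Lemma adapted_weighted_family (F : nat -> set (set T)) w M S :
  (forall i, i \in S -> adapted F (M i)) -> adapted F (weighted_family w M S).
Proof.
move=> aM t.
(* Summing over the type of elements of [S] keeps the membership proof with
   each index: outside [S] nothing makes [M i] measurable. *)
apply: (eq_measurable_fun (fun x : g_sigma_algebraType (F t) =>
    1 + \sum_(i : S) w (val i) * (M (val i) t x - 1))).
  by move=> x _; rewrite /weighted_family big_seq_fsetE.
apply: measurable_funD => //; apply: measurable_sum => i.
apply: measurable_funM => //; apply: measurable_funB => //.
exact: aM (fsvalP i) t.
Qed.

(** An inequality rather than an equality because stopped values are [0] where
    the time is infinite, while the convex combination is then [1 - W]. *)
Lemma stopped_weighted_family_le w M S (tau : T -> option nat) x :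
  \sum_(i <- S) w i <= 1 ->
  stopped (weighted_family w M S) tau x <=
  (1 - \sum_(i <- S) w i) + \sum_(i <- S) w i * stopped (M i) tau x.
Proof.
move=> W1; rewrite /stopped; case: (tau x) => [t|].
  by rewrite weighted_family_convexE.
by rewrite [X in _ + X]big1 ?addr0 ?subr_ge0// => i _; rewrite mulr0.
Qed.

(** Linearity of the expectation is the only property of the joint law that is
    used, which is why the dependence among the [M i] is arbitrary. *)
Lemma weighted_family_e_process (F : nat -> set (set T))
    (H : nat -> set (probability T R)) (K : set (probability T R)) w M S :
  filtration F ->
  (forall i, i \in S -> 0 <= w i) -> \sum_(i <- S) w i <= 1 ->
  (forall i, i \in S -> e_process F (H i) (M i)) ->
  (forall i, i \in S -> K `<=` H i) ->
  e_process F K (weighted_family w M S).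
Proof.
move=> fF w0 W1 eM KH.
have M0 i t x : i \in S -> 0 <= M i t x by move=> /eM[].
have aM i : i \in S -> adapted F (M i) by move=> /eM[].
have sM0 i tau x : i \in S -> 0 <= stopped (M i) tau x.
  by move=> iS; rewrite /stopped; case: (tau x) => // t; exact: M0.
have E0 t x : 0 <= weighted_family w M S t x.
  rewrite weighted_family_convexE addr_ge0 ?subr_ge0// big_seq.
  by apply: sumr_ge0 => i iS; rewrite mulr_ge0 ?w0 ?M0.
have aE : adapted F (weighted_family w M S) by exact: adapted_weighted_family.
split => // P tau KP st tau_fin.
have msM i : i \in S -> measurable_fun [set: T] (stopped (M i) tau).
  by move=> iS; apply: (@measurable_stopped _ _ _ F) => //; exact: aM.
set W := \sum_(i <- S) w i.
pose f (i : S) x : \bar R :=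
  ((w (val i))%:E * (stopped (M (val i)) tau x)%:E)%E.
have mf i : measurable_fun [set: T] (f i).
  apply: emeasurable_funM => //; apply/measurable_EFinP.
  exact: msM (fsvalP i).
have f0 i x : [set: T] x -> (0 <= f i x)%E.
  by move=> _; rewrite mule_ge0// lee_fin ?w0 ?sM0// fsvalP.
have sf0 x : [set: T] x -> (0 <= \sum_(i : S) f i x)%E.
  by move=> _; apply: sume_ge0 => i _; exact: f0.
have msf : measurable_fun [set: T] (fun x => \sum_(i : S) f i x)%E.
  exact: emeasurable_sum.
have W0 : (0 <= (1 - W)%:E)%E by rewrite lee_fin subr_ge0.
rewrite unlock.
apply: (@le_trans _ _ (\int[P]_x ((1 - W)%:E + \sum_(i : S) f i x)))%E.
  apply: ge0_le_integral => //.
  - by move=> x _; rewrite lee_fin /stopped; case: (tau x).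
  - by apply/measurable_EFinP; apply: (@measurable_stopped _ _ _ F).
  - exact: emeasurable_funD.
  - move=> x _; have := @stopped_weighted_family_le w M S tau x W1.
    rewrite -lee_fin => le1; apply: (le_trans le1).
    by rewrite EFinD leeD2l// big_seq_fsetE/= -sumEFin.
rewrite ge0_integralD// integral_cst// [X in (_ * X + _)%E]probability_setT.
rewrite mule1 ge0_integral_sum//.
rewrite -[leRHS](_ : (1 - W)%:E + W%:E = 1)%E; last by rewrite -EFinD subrK.
rewrite leeD2l// /W big_seq_fsetE/= -sumEFin; apply: lee_sum => i _.
have iS := fsvalP i.
rewrite ge0_integralZl_EFin//; last 3 first.
- by move=> x _; rewrite lee_fin sM0.
- by apply/measurable_EFinP; exact: msM.
- exact: w0.
rewrite -[leRHS]mule1 lee_wpmul2l ?lee_fin ?w0//.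
have [_ _ /(_ P tau (KH _ iS _ KP) st tau_fin)] := eM _ iS.
by rewrite unlock.
Qed.

Lemma extend_empty_weighted_family w M S :
  extend_empty (fun _ _ => 1) (weighted_family w M) S = weighted_family w M S.
Proof.
rewrite /extend_empty; case: eqVneq => // ->.
apply/funext => t; apply/funext => x.
by rewrite /weighted_family big_seq_fset0 addr0.
Qed.

End WeightedFamily.

Lemma fset_sum_le_esum (R : realType) (U : choiceType) (I : set U)
    (w : U -> R) (S : {fset U}) :
  [set` S] `<=` I -> ((\sum_(i <- S) w i)%:E <= \esum_(i in I) (w i)%:E)%E.
Proof.
move=> SI; apply: esum_ge; exists [set` S]; first by split.
by rewrite fsbig_finite//= set_fsetK sumEFin.
Qed.

Lemma lt_activation_time (I : set nat) (A : nat -> {fset nat}) (i t : nat) :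
  active_sets I A -> I i -> i \notin A t -> (t < activation_time A i)%N.
Proof.
move=> [Amono AI] Ii; apply: contraNltn; rewrite /activation_time.
case: pselect => [ex|nex].
  case: ex_minnP => m im _ mt.
  by move/fsubsetP: (Amono _ _ mt); apply.
by exfalso; apply: nex; move: Ii; rewrite -AI => -[s _ /= is_]; exists s.
Qed.

Theorem corollary4p10 (d : measure_display) (T : measurableType d)
    (R : realType) (F : nat -> set (set T)) (MM : set (probability T R))
    (I : set nat) (H : nat -> set (probability T R)) (A : nat -> {fset nat})
    (w : nat -> R) (M : nat -> nat -> T -> R) :
  filtration F ->
  (forall i, I i -> H i `<=` MM) ->
  active_sets I A ->
  (forall i, I i -> 0 <= w i) ->
  (\esum_(i in I) (w i)%:E <= 1)%E ->
  (forall i, I i -> e_process F (H i) (M i)) ->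
  (forall i t x, I i -> (t < activation_time A i)%N -> M i t x = 1) ->
  dynamic_intersection_e_process_collection F MM I H (weighted_family w M) /\
  neutral_padding_projectively_consistent F I A (weighted_family w M).
Proof.
move=> fF _ actA w0 w1 eM dormant; split.
  move=> S SI _; apply: (@weighted_family_e_process _ _ _ F H) => //.
  - by move=> i /SI/w0.
  - by rewrite -lee_fin; apply: le_trans w1; exact: fset_sum_le_esum.
  - by move=> i /SI/eM.
  - by move=> i iS P [_]; exact.
exists (fun _ _ => 1) => [t|S SI t x]; first exact: measurable_cst.
rewrite !extend_empty_weighted_family /weighted_family; congr (_ + _).
apply/esym/big_fset_incl; first exact: fsubsetIl.
move=> i iS; rewrite inE iS/= => iA.
have Ii := SI _ iS.
by rewrite dormant ?subrr ?mulr0//; exact: lt_activation_time actA Ii iA.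
Qed.
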